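(* Let $\mathbf{PCL}=\mathbf{CL}(\{p\wedge(q\vee r)\trianglelefteq(p\wedge q)\vee(p\wedge r)\})$. Then $\mathbf{PCL}$ is sound and complete with respect to the class of distributive selection L-frames: a consequence pair belongs to $\mathbf{PCL}$ iff it is validated by every selection L-frame whose underlying semilattice is distributive.
   Context: Formulas: $\phi::=p\mid\top\mid\bot\mid\phi\wedge\phi\mid\phi\vee\phi\mid\phi\Rightarrow\phi$. $\mathbf{CL}(\Gamma)$ is the smallest set of consequence pairs $\phi\trianglelefteq\psi$ containing $\Gamma$, closed under uniform substitution, containing $p\trianglelefteq\top$, $\bot\trianglelefteq p$, $p\trianglelefteq p$, $p\wedge q\trianglelefteq p$, $p\wedge q\trianglelefteq q$, $p\trianglelefteq p\vee q$, $q\trianglelefteq p\vee q$, $\top\trianglelefteq p\Rightarrow\top$, $p\Rightarrow(q\wedge r)\trianglelefteq(p\Rightarrow q)\wedge(p\Rightarrow r)$, $(p\Rightarrow q)\wedge(p\Rightarrow r)\trianglelefteq p\Rightarrow(q\wedge r)$, closed under transitivity, $\wedge$-introduction (from $r\trianglelefteq p,r\trianglelefteq q$ infer $r\trianglelefteq p\wedge q$), $\vee$-elimination (from $p\trianglelefteq r,q\trianglelefteq r$ infer $p\vee q\trianglelefteq r$), and congruence for $\Rightarrow$ in each argument. A meet-semilattice $(X,1,\curlywedge)$ (order $x\preccurlyeq y$ iff $x\curlywedge y=x$) is distributive if whenever $x\curlywedge y\preccurlyeq z$ there exist $u,v$ with $x\preccurlyeq u$, $y\preccurlyeq v$ and $z=u\curlywedge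 v$. A selection L-frame is $(X,1,\curlywedge,s)$ with $s:X\times\mathcal F(X)\to\mathcal F(X)$ ($\mathcal F(X)$ the filters: upward closed, closed under finite meets) such that $s(1,a)=\{1\}$; $x\preccurlyeq y$ implies $s(y,a)\subseteq s(x,a)$; if $z\in s(x\curlywedge y,a)$ there are $u\in s(x,a)$, $v\in s(y,a)$ with $u\curlywedge v\preccurlyeq z$. Under a valuation $V$ (letters to filters): $x\Vdash p$ iff $x\in V(p)$; $\top$ always; $x\Vdash\bot$ iff $x=1$; $\wedge$ pointwise; $x\Vdash\phi\vee\psi$ iff some $y\Vdash\phi$, $z\Vdash\psi$ have $y\curlywedge z\preccurlyeq x$; $x\Vdash\phi\Rightarrow\psi$ iff $s(x,[\![\phi]\!])\subseteq[\![\psi]\!]$. A frame validates $\phi\trianglelefteq\psi$ if $[\![\phi]\!]\subseteq[\![\psi]\!]$ for all valuations. *)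

(* Defs.v *)
From mathcomp Require Import all_boot all_order.
From mathcomp Require Import boolp classical_sets.
Set Implicit Arguments.
Unset Strict Implicit.
Unset Printing Implicit Defensive.
Import Order.TTheory.
Local Open Scope classical_set_scope.
Local Open Scope order_scope.

Inductive formula (L : Type) : Type :=
  | Letter of L
  | Top
  | Bot
  | And of formula L & formula L
  | Or of formula L & formula L
  | Imp of formula L & formula L.

Arguments Top {L}.
Arguments Bot {L}.

Declare Scope cform_scope.
Delimit Scope cform_scope with cform.
Bind Scope cform_scope with formula.
Notation "⊤" := Top : cform_scope.
Notation "⊥" := Bot : cform_scope.
Notation "phi ∧ psi" := (And phi psi)
  (at level 40, left associativity) : cform_scope.
Notation "phi ∨ psi" := (Or phi psi)
  (at level 50, left associativity) : cform_scope.
Notation "phi ⇒ psi" := (Imp phi psi)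
  (at level 55, right associativity) : cform_scope.

Record cpair (L : Type) := CPair { cp_lhs : formula L; cp_rhs : formula L }.

Notation "phi ⊴ psi" := (CPair phi%cform psi%cform)
  (at level 60, no associativity) : cform_scope.
Bind Scope cform_scope with cpair.

Fixpoint subst (L : Type) (sigma : L -> formula L) (phi : formula L) :
    formula L :=
  match phi with
  | Letter p => sigma p
  | Top => ⊤
  | Bot => ⊥
  | And phi psi => subst sigma phi ∧ subst sigma psi
  | Or phi psi => subst sigma phi ∨ subst sigma psi
  | Imp phi psi => subst sigma phi ⇒ subst sigma psi
  end%cform.

Definition csubst (L : Type) (sigma : L -> formula L) (c : cpair L) : cpair L :=
  CPair (subst sigma (cp_lhs c)) (subst sigma (cp_rhs c)).

(* The axioms are stated for letters, since [CL_subst] yields their instances;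
   in the remaining rules [phi], [psi], [chi] are arbitrary formulas. *)
Inductive CL (L : Type) (Gamma : set (cpair L)) : cpair L -> Prop :=
  | CL_base c : Gamma c -> CL Gamma c
  | CL_subst sigma c : CL Gamma c -> CL Gamma (csubst sigma c)
  | CL_top p : CL Gamma (Letter p ⊴ ⊤)
  | CL_bot p : CL Gamma (⊥ ⊴ Letter p)
  | CL_refl p : CL Gamma (Letter p ⊴ Letter p)
  | CL_andl p q : CL Gamma (Letter p ∧ Letter q ⊴ Letter p)
  | CL_andr p q : CL Gamma (Letter p ∧ Letter q ⊴ Letter q)
  | CL_orl p q : CL Gamma (Letter p ⊴ Letter p ∨ Letter q)
  | CL_orr p q : CL Gamma (Letter q ⊴ Letter p ∨ Letter q)
  | CL_imp_top p : CL Gamma (⊤ ⊴ (Letter p ⇒ ⊤))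
  | CL_imp_and p q r :
      CL Gamma ((Letter p ⇒ (Letter q ∧ Letter r)) ⊴
                ((Letter p ⇒ Letter q) ∧ (Letter p ⇒ Letter r)))
  | CL_and_imp p q r :
      CL Gamma (((Letter p ⇒ Letter q) ∧ (Letter p ⇒ Letter r)) ⊴
                (Letter p ⇒ (Letter q ∧ Letter r)))
  | CL_trans phi psi chi :
      CL Gamma (phi ⊴ psi) -> CL Gamma (psi ⊴ chi) -> CL Gamma (phi ⊴ chi)
  | CL_and_intro phi psi chi :
      CL Gamma (chi ⊴ phi) -> CL Gamma (chi ⊴ psi) ->
      CL Gamma (chi ⊴ phi ∧ psi)
  | CL_or_elim phi psi chi :
      CL Gamma (phi ⊴ chi) -> CL Gamma (psi ⊴ chi) ->
      CL Gamma (phi ∨ psi ⊴ chi)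
  | CL_congl phi psi chi :
      CL Gamma (phi ⊴ psi) -> CL Gamma (psi ⊴ phi) ->
      CL Gamma ((phi ⇒ chi) ⊴ (psi ⇒ chi))
  | CL_congr phi psi chi :
      CL Gamma (phi ⊴ psi) -> CL Gamma (psi ⊴ phi) ->
      CL Gamma ((chi ⇒ phi) ⊴ (chi ⇒ psi)).

Definition PCL (L : Type) (p q r : L) : set (cpair L) :=
  CL [set (Letter p ∧ (Letter q ∨ Letter r) ⊴
          (Letter p ∧ Letter q) ∨ (Letter p ∧ Letter r))%cform].

Definition distributive_msl (d : Order.disp_t) (X : tMeetSemilatticeType d) :=
  forall x y z : X, x `&` y <= z ->
    exists u v : X, [/\ x <= u, y <= v & z = u `&` v].

Record is_sfilter (d : Order.disp_t) (X : tMeetSemilatticeType d)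
    (A : set X) : Prop := IsSfilter {
  sfilterT : A \top;
  sfilterI : forall x y, A x -> A y -> A (x `&` y);
  sfilterS : forall x y, x <= y -> A x -> A y }.

Record sfilter (d : Order.disp_t) (X : tMeetSemilatticeType d) := Sfilter {
  sfilter_set :> set X;
  sfilterP : is_sfilter sfilter_set }.

Record selLframe (d : Order.disp_t) := SelLframe {
  sl_base :> tMeetSemilatticeType d;
  sel : sl_base -> sfilter sl_base -> sfilter sl_base;
  sel_top : forall a, sel \top a = [set \top] :> set sl_base;
  sel_anti : forall x y a, x <= y -> sel y a `<=` sel x a;
  sel_meet : forall x y a z, sfilter_set (sel (x `&` y) a) z ->
    exists u v, [/\ sfilter_set (sel x a) u, sfilter_set (sel y a) v
                  & u `&` v <= z] }.

Section FilterOperations.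
Variables (d : Order.disp_t) (F : selLframe d).
Implicit Types A B : sfilter F.

Lemma is_sfilter_top : is_sfilter [set: F].
Proof. by []. Qed.

Lemma is_sfilter_bot : is_sfilter [set \top : F].
Proof.
split=> //= [x y -> ->|x y xy x1]; first by rewrite meetxx.
by apply/eqP; rewrite -le1x -x1.
Qed.

Lemma is_sfilter_and A B : is_sfilter (A `&` B)%classic.
Proof.
case: A B => A [AT AI AS] [B [BT BI BS]]; split=> //=.
- by move=> x y [? ?] [? ?]; split; [exact: AI|exact: BI].
- by move=> x y xy [? ?]; split; [exact: AS xy _|exact: BS xy _].
Qed.

Lemma is_sfilter_or A B :
  is_sfilter [set x : F | exists y z, [/\ sfilter_set A y, sfilter_set B z & y `&` z <= x]].
Proof.
case: A B => A [AT AI AS] [B [BT BI BS]]; split=> /=.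
- by exists \top, \top; split=> //; exact: lex1.
- move=> x x' [y [z [Ay Bz le]]] [y' [z' [Ay' Bz' le']]].
  exists (y `&` y'), (z `&` z'); split; [exact: AI|exact: BI|].
  by rewrite meetACA leI2.
- by move=> x x' xx' [y [z [? ? le]]]; exists y, z; split=> //; exact: le_trans xx'.
Qed.

Lemma is_sfilter_imp A B : is_sfilter [set x : F | sel x A `<=` B].
Proof.
case: B => B [BT BI BS]; split=> /=.
- by rewrite sel_top => x ->.
- move=> x y xB yB z /sel_meet[u [v [/xB Bu /yB Bv le]]].
  by apply: BS le _; exact: BI.
- by move=> x y xy xB z /(sel_anti xy)/xB.
Qed.

End FilterOperations.

(* [interp V phi x] is [x ⊩ phi]; truth sets are bundled as filters because
   the selection function is only defined on filters. *)
Fixpoint interp (L : Type) (d : Order.disp_t) (F : selLframe d)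
    (V : L -> sfilter F) (phi : formula L) : sfilter F :=
  match phi with
  | Letter p => V p
  | Top => Sfilter (is_sfilter_top F)
  | Bot => Sfilter (is_sfilter_bot F)
  | And phi psi => Sfilter (is_sfilter_and (interp V phi) (interp V psi))
  | Or phi psi => Sfilter (is_sfilter_or (interp V phi) (interp V psi))
  | Imp phi psi => Sfilter (is_sfilter_imp (interp V phi) (interp V psi))
  end.

Definition validates (L : Type) (d : Order.disp_t) (F : selLframe d)
    (c : cpair L) : Prop :=
  forall V : L -> sfilter F, interp V (cp_lhs c) `<=` interp V (cp_rhs c).

(* Main.v *)
(** Soundness is an induction on derivations; distributivity of the semilattice
    is exactly what splits a world above [y `&` z] as required by the
    distributive law.

    For completeness, take as worlds the theories, ordered by inclusion, with
    intersection as meet and the inconsistent theory as top.  The truth set of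
    [phi] is the set of theories containing [phi], and [sel x a] is the
    principal filter of the theory of all [psi] with [phi ⇒ psi] in [x] for
    every [phi] whose truth set is [a].  If [a] is not a truth set then this
    theory is inconsistent, so no case distinction is needed.  Theories over a
    distributive calculus form a distributive lattice, and a pair is refuted at
    the theory generated by its antecedent. *)

From HB Require Import structures.
Require Import Defs.
From mathcomp Require Import all_boot all_order.
From mathcomp Require Import boolp classical_sets.

Set Implicit Arguments.
Unset Strict Implicit.
Unset Printing Implicit Defensive.
Import Order.TTheory.
Local Open Scope classical_set_scope.
Local Open Scope order_scope.
#[local] Obligation Tactic := idtac.

(** * Soundness *)

Lemma sfilter_ext (d : Order.disp_t) (X : tMeetSemilatticeType d)
    (A B : sfilter X) : (forall x, sfilter_set A x <-> sfilter_set B x) -> A = B.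
Proof.
case: A B => [A fA] [B fB] /= AB.
have {}AB : A = B by apply/seteqP; split=> x /AB.
by case: B / AB fB => fB; congr Sfilter; exact: Prop_irrelevance.
Qed.

Lemma interp_subst (L : Type) (d : Order.disp_t) (F : selLframe d)
    (V : L -> sfilter F) (sigma : L -> formula L) (phi : formula L) :
  interp V (subst sigma phi) = interp (fun l => interp V (sigma l)) phi.
Proof. by elim: phi => //= phi -> psi ->. Qed.

Lemma CL_sound (L : Type) (Gamma : set (cpair L)) (d : Order.disp_t)
    (F : selLframe d) (c : cpair L) :
  (forall g, Gamma g -> validates F g) -> CL Gamma c -> validates F c.
Proof.
move=> GF; elim=> {c}.
- by [].
- by move=> sigma c _ IH V; rewrite /= !interp_subst; exact: IH.
- by [].
- by move=> l V x /= ->; exact: sfilterT (sfilterP _).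
- by move=> l V x.
- by move=> l m V x [].
- by move=> l m V x [].
- move=> l m V x /= lx; exists x, \top; split=> //; last exact: leIl.
  exact: sfilterT (sfilterP _).
- move=> l m V x /= mx; exists \top, x; split=> //; last exact: leIr.
  exact: sfilterT (sfilterP _).
- by [].
- by move=> l m n V x /= lmn; split=> y /lmn [].
- by move=> l m n V x /= [lm ln] y ly; split; [exact: lm|exact: ln].
- by move=> phi psi chi _ IH1 _ IH2 V x /(IH1 V)/(IH2 V).
- by move=> phi psi chi _ IH1 _ IH2 V x cx; split; [exact: IH1|exact: IH2].
- move=> phi psi chi _ IH1 _ IH2 V x [y [z [/(IH1 V) cy /(IH2 V) cz yzx]]] /=.
  apply: sfilterS (sfilterP _) _ _ yzx _.
  exact: sfilterI (sfilterP _) _ _ cy cz.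
- move=> phi psi chi _ IH1 _ IH2 V x /=.
  (* [sel] carries no monotonicity in its filter argument, so inclusion would not suffice: the two
     truth filters have to be equal. *)
  suff -> : interp V phi = interp V psi by [].
  by apply: sfilter_ext => y; split; [exact: IH1|exact: IH2].
- by move=> phi psi chi _ IH1 _ _ V x /= cx y /cx /(IH1 V).
Qed.

Lemma distributive_validates (L : Type) (p q r : L) (d : Order.disp_t)
    (F : selLframe d) :
  distributive_msl F ->
  validates F (Letter p ∧ (Letter q ∨ Letter r) ⊴
               (Letter p ∧ Letter q) ∨ (Letter p ∧ Letter r)).
Proof.
move=> dF V x [/= px [y [z [qy rz /dF [u [v [yu zv xuv]]]]]]].
(* Both [u] and [v] lie above [x = u ∧ v] and so inherit [p]; [q] and [r] come up from [y] and
   [z]. *)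
exists u, v; split; last by rewrite xuv.
- split; last exact: sfilterS (sfilterP _) _ _ yu qy.
  by apply: sfilterS (sfilterP _) _ _ _ px; rewrite xuv leIl.
- split; last exact: sfilterS (sfilterP _) _ _ zv rz.
  by apply: sfilterS (sfilterP _) _ _ _ px; rewrite xuv leIr.
Qed.

(** * The semilattice of theories *)

Lemma is_sfilter_principal (d : Order.disp_t) (X : tMeetSemilatticeType d)
    (t : X) : is_sfilter [set y | t <= y].
Proof.
split=> /= [|y z|y z yz ty]; first exact: lex1.
  by move=> ty tz; rewrite lexI ty.
exact: le_trans yz.
Qed.

(** These are the filters of the Lindenbaum algebra, described on formulas. *)
Record theory (L : Type) (Gamma : set (cpair L)) := Theory {
  theory_set :> formula L -> Prop;
  theory_top : theory_set Top;
  theory_and phi psi :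
    theory_set phi -> theory_set psi -> theory_set (And phi psi);
  theory_closed phi psi :
    CL Gamma (CPair phi psi) -> theory_set phi -> theory_set psi }.

Section TheorySemilattice.
Variables (L : Type) (Gamma : set (cpair L)).
Implicit Types x y z : theory Gamma.

Lemma theory_ext x y : theory_set x = theory_set y -> x = y.
Proof.
case: x y => [x xT xI xS] [y yT yI yS] /= xy.
by case: y / xy yT yI yS => *; congr Theory; exact: Prop_irrelevance.
Qed.

HB.instance Definition _ := gen_eqMixin (theory Gamma).
HB.instance Definition _ := gen_choiceMixin (theory Gamma).

Definition theory_le x y : bool := `[< theory_set x `<=` theory_set y >].

Lemma theory_lexx : reflexive theory_le.
Proof. by move=> x; apply/asboolP. Qed.

Lemma theory_le_anti : antisymmetric theory_le.
Proof.
move=> x y /andP[/asboolP xy /asboolP yx].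
by apply: theory_ext; apply/seteqP; split.
Qed.

Lemma theory_le_trans : transitive theory_le.
Proof.
by move=> y x z /asboolP xy /asboolP yz; apply/asboolP; exact: subset_trans yz.
Qed.

Fact theory_display : Order.disp_t. Proof. exact: Order.Disp tt tt. Qed.

HB.instance Definition _ := Order.Le_isPOrder.Build theory_display
  (theory Gamma) theory_lexx theory_le_anti theory_le_trans.

Program Definition theory_meet x y : theory Gamma :=
  @Theory L Gamma (theory_set x `&` theory_set y)%classic _ _ _.
Next Obligation. by move=> x y; split; exact: theory_top. Qed.
Next Obligation.
by move=> x y phi psi [? ?] [? ?]; split; exact: theory_and.
Qed.
Next Obligation.
by move=> x y phi psi le [? ?]; split; exact: theory_closed le _.
Qed.

Lemma theory_lexI x y z :
  (x <= theory_meet y z) = (x <= y) && (x <= z).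
Proof.
apply/asboolP/andP => [xyz|[/asboolP xy /asboolP xz] phi xphi].
  by split; apply/asboolP => phi /xyz [].
by split; [exact: xy|exact: xz].
Qed.

HB.instance Definition _ := Order.POrder_isMeetSemilattice.Build theory_display
  (theory Gamma) theory_lexI.

Definition theory_full : theory Gamma :=
  @Theory L Gamma setT I (fun _ _ _ _ => I) (fun _ _ _ _ => I).

Lemma theory_lex1 x : x <= theory_full.
Proof. by apply/asboolP. Qed.

HB.instance Definition _ := Order.hasTop.Build theory_display
  (theory Gamma) theory_lex1.

Lemma theory_leP x y : reflect (theory_set x `<=` theory_set y) (x <= y).
Proof. exact: asboolP. Qed.

Definition theory_filter (phi : formula L) : set (theory Gamma) :=
  [set x | x phi].

End TheorySemilattice.

(** * The canonical frame *)

Section CanonicalFrame.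
Variables (L : Type) (Gamma : set (cpair L)) (p q r : L).
Hypotheses (hpq : p <> q) (hpr : p <> r) (hqr : q <> r).
Implicit Types (phi psi chi : formula L) (x y z : theory Gamma).
Local Notation "phi ⊢ psi" := (CL Gamma (CPair phi%cform psi%cform))
  (at level 60, no associativity).

(** The axioms concern letters only, so three distinct letters serve as slots that turn them into
    schemes. The value at any further letter is immaterial, as the instantiated axioms contain only
    [p], [q] and [r]. *)
Definition inst phi psi chi (l : L) : formula L :=
  if `[< l = p >] then phi else if `[< l = q >] then psi else chi.

Lemma instp phi psi chi : inst phi psi chi p = phi.
Proof. by rewrite /inst asboolT. Qed.

Lemma instq phi psi chi : inst phi psi chi q = psi.
Proof. by rewrite /inst asboolF ?asboolT // => /esym. Qed.

Lemma instr phi psi chi : inst phi psi chi r = chi.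
Proof. by rewrite /inst !asboolF // => /esym. Qed.

Lemma CL_inst phi psi chi c : CL Gamma c ->
  CL Gamma (csubst (inst phi psi chi) c).
Proof. exact: CL_subst. Qed.

Ltac instantiate_axiom phi psi chi ax :=
  have := CL_inst phi psi chi ax; by rewrite /csubst /= ?instp ?instq ?instr.

Lemma CLxx phi : phi ⊢ phi.
Proof. instantiate_axiom phi phi phi (CL_refl Gamma p). Qed.

Lemma CLx1 phi : phi ⊢ ⊤.
Proof. instantiate_axiom phi phi phi (CL_top Gamma p). Qed.

Lemma CL0x phi : ⊥ ⊢ phi.
Proof. instantiate_axiom phi phi phi (CL_bot Gamma p). Qed.

Lemma CLIl phi psi : phi ∧ psi ⊢ phi.
Proof. instantiate_axiom phi psi psi (CL_andl Gamma p q). Qed.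

Lemma CLIr phi psi : phi ∧ psi ⊢ psi.
Proof. instantiate_axiom phi psi psi (CL_andr Gamma p q). Qed.

Lemma CLUl phi psi : phi ⊢ phi ∨ psi.
Proof. instantiate_axiom phi psi psi (CL_orl Gamma p q). Qed.

Lemma CLUr phi psi : psi ⊢ phi ∨ psi.
Proof. instantiate_axiom phi psi psi (CL_orr Gamma p q). Qed.

Lemma CL_impT phi : ⊤ ⊢ phi ⇒ ⊤.
Proof. instantiate_axiom phi phi phi (CL_imp_top Gamma p). Qed.

Lemma CL_impI phi psi chi : (phi ⇒ psi ∧ chi) ⊢ (phi ⇒ psi) ∧ (phi ⇒ chi).
Proof. instantiate_axiom phi psi chi (CL_imp_and Gamma p q r). Qed.

Lemma CL_Iimp phi psi chi : (phi ⇒ psi) ∧ (phi ⇒ chi) ⊢ (phi ⇒ psi ∧ chi).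
Proof. instantiate_axiom phi psi chi (CL_and_imp Gamma p q r). Qed.

Lemma CLI2 phi phi' psi psi' :
  phi ⊢ phi' -> psi ⊢ psi' -> phi ∧ psi ⊢ phi' ∧ psi'.
Proof.
move=> ? ?; apply: CL_and_intro.
  exact: CL_trans (CLIl _ _) _.
exact: CL_trans (CLIr _ _) _.
Qed.

(* The calculus has only congruence for [⇒]; monotonicity on the right comes
   from [psi] being equivalent to [psi ∧ chi]. *)
Lemma CL_imp_mono phi psi chi : psi ⊢ chi -> (phi ⇒ psi) ⊢ (phi ⇒ chi).
Proof.
move=> le; apply: CL_trans (CLIr (phi ⇒ psi)%cform _).
apply: CL_trans (CL_impI _ _ _); apply: CL_congr; last exact: CLIl.
by apply: CL_and_intro => //; exact: CLxx.
Qed.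

(** * Principal theories, truth sets and the canonical selection function *)

Program Definition up phi : theory Gamma :=
  @Theory L Gamma (fun psi => phi ⊢ psi) _ _ _.
Next Obligation. by move=> phi; exact: CLx1. Qed.
Next Obligation. by move=> phi psi chi; exact: CL_and_intro. Qed.
Next Obligation. by move=> phi psi chi le /CL_trans; exact. Qed.

Lemma up_le phi x : (up phi <= x) <-> x phi.
Proof.
split=> [/theory_leP|xphi]; first by apply; exact: CLxx.
by apply/theory_leP => psi le; exact: theory_closed le xphi.
Qed.

Lemma theory_filterP phi : is_sfilter (@theory_filter L Gamma phi).
Proof.
split=> //= x y; last by move=> /theory_leP; exact.
Qed.

Definition truth phi : sfilter (theory Gamma) := Sfilter (theory_filterP phi).

(** Testing the inclusion at [up phi] suffices. Consequently a truth set determines its formula up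
    to interderivability. *)
Lemma truth_le phi psi : truth phi `<=` truth psi -> phi ⊢ psi.
Proof. by move/(_ (up phi)); apply; exact: CLxx. Qed.

Program Definition sel_theory x (a : sfilter (theory Gamma)) :
    theory Gamma := @Theory L Gamma
  [set psi | forall phi, a = truth phi -> x (phi ⇒ psi)%cform] _ _ _.
Next Obligation.
by move=> x a phi _; apply: theory_closed (CL_impT _) _; exact: theory_top.
Qed.
Next Obligation.
move=> x a psi chi xpsi xchi phi aphi; apply: theory_closed (CL_Iimp _ _ _) _.
by apply: theory_and; [exact: xpsi|exact: xchi].
Qed.
Next Obligation.
by move=> x a psi chi le xpsi phi /xpsi; exact/theory_closed/CL_imp_mono.
Qed.

(** Formulas sharing a truth set are interderivable, so congruence in the antecedent lets one
    representative [phi] decide for all. *)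
Lemma sel_theory_truth x phi psi :
  sel_theory x (truth phi) psi <-> x (phi ⇒ psi)%cform.
Proof.
split=> [|xpsi chi e]; first exact.
by apply: theory_closed xpsi; apply: CL_congl; apply: truth_le; rewrite e.
Qed.

Definition canonical_sel x (a : sfilter (theory Gamma)) :
  sfilter (theory Gamma) := Sfilter (is_sfilter_principal (sel_theory x a)).

Lemma canonical_sel_top a : canonical_sel \top a = [set \top] :> set _.
Proof.
apply/seteqP; split=> [y /= /theory_leP le|y /= ->]; last exact: lex1.
(* The theory [\top] contains every implication, so [sel_theory \top a] is already the full
   theory. *)
by apply/le_anti; rewrite lex1; apply/theory_leP => phi _; apply: le.
Qed.

Lemma canonical_sel_anti x y a :
  x <= y -> canonical_sel y a `<=` canonical_sel x a.
Proof.
move=> /theory_leP xy z; apply: le_trans; apply/theory_leP => psi xpsi phi aphi.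
by apply: xy; exact: xpsi.
Qed.

(** An implication in both [x] and [y] is in their intersection, so the generators of the two
    selected filters meet below that of [x ∧ y] and serve as witnesses. *)
Lemma canonical_sel_meet x y a z : sfilter_set (canonical_sel (x `&` y) a) z ->
  exists u v, [/\ sfilter_set (canonical_sel x a) u,
                  sfilter_set (canonical_sel y a) v & u `&` v <= z].
Proof.
move=> /= le; exists (sel_theory x a), (sel_theory y a); split=> //=.
apply: le_trans le; apply/theory_leP => psi [xpsi ypsi] phi aphi.
by split; [exact: xpsi|exact: ypsi].
Qed.

Definition canonical_frame : selLframe theory_display :=
  SelLframe canonical_sel_top canonical_sel_anti canonical_sel_meet.

Lemma canonical_interp phi :
  interp (F := canonical_frame) (fun l => truth (Letter l)) phi = truth phi.
Proof.
elim: phi => [l||| phi IH1 psi IH2| phi IH1 psi IH2| phi IH1 psi IH2] //=;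
  rewrite ?IH1 ?IH2; apply: sfilter_ext => x /=.
- by split=> // _; exact: theory_top.
- split=> [-> //|x0].
  apply/le_anti; rewrite lex1; apply/theory_leP => phi _.
  exact: theory_closed (CL0x phi) x0.
- split=> [[xphi xpsi]|xI]; first exact: theory_and.
  split; first exact: theory_closed (CLIl _ _) xI.
  exact: theory_closed (CLIr _ _) xI.
- split=> [[y [z [yphi zpsi /theory_leP le]]]|xU].
    apply: le; split; first exact: theory_closed (CLUl _ _) yphi.
    exact: theory_closed (CLUr _ _) zpsi.
  (* A common consequence of [phi] and [psi] follows from [phi ∨ psi], hence [up phi] and [up psi]
     intersect inside [x]. *)
  exists (up phi), (up psi); split; [exact: CLxx|exact: CLxx|].
  apply/theory_leP => chi [le1 le2].
  by apply: theory_closed xU; exact: CL_or_elim.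
- split=> [le|xphi y /theory_leP le]; last by apply: le; apply/sel_theory_truth.
  (* The selected filter is principal, so the inclusion is tested at its generator. *)
  by apply/sel_theory_truth; exact: le (lexx (sel_theory x (truth phi))).
Qed.

Lemma canonical_complete phi psi :
  validates canonical_frame (CPair phi psi) -> phi ⊢ psi.
Proof.
move=> /(_ (fun l => truth (Letter l))).
by rewrite /= !canonical_interp => /truth_le.
Qed.

(** * Distributivity of the semilattice of theories *)

Hypothesis CL_distr_letters : Letter p ∧ (Letter q ∨ Letter r) ⊢
  (Letter p ∧ Letter q) ∨ (Letter p ∧ Letter r).

Lemma CL_distr phi psi chi : phi ∧ (psi ∨ chi) ⊢ (phi ∧ psi) ∨ (phi ∧ chi).
Proof. instantiate_axiom phi psi chi CL_distr_letters. Qed.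

(** The theory generated by the union; closure under conjunction makes one formula from each side
    enough. *)
Program Definition theory_join x y : theory Gamma := @Theory L Gamma
  [set chi | exists phi psi, [/\ x phi, y psi & phi ∧ psi ⊢ chi]] _ _ _.
Next Obligation.
move=> x y; exists Top, Top.
by split; [exact: theory_top|exact: theory_top|exact: CLx1].
Qed.
Next Obligation.
move=> x y chi chi' [phi [psi [xphi ypsi le]]] [phi' [psi' [xphi' ypsi' le']]].
exists (And phi phi'), (And psi psi').
split; [exact: theory_and|exact: theory_and|].
apply: CL_and_intro.
  by apply: CL_trans le; apply: CLI2; exact: CLIl.
by apply: CL_trans le'; apply: CLI2; exact: CLIr.
Qed.
Next Obligation.
move=> x y chi chi' le [phi [psi [xphi ypsi le']]].
by exists phi, psi; split=> //; exact: CL_trans le.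
Qed.

Lemma theory_le_joinl x y : x <= theory_join x y.
Proof.
apply/theory_leP => phi xphi; exists phi, Top.
by split; [|exact: theory_top|exact: CLIl].
Qed.

Lemma theory_le_joinr x y : y <= theory_join x y.
Proof.
apply/theory_leP => psi ypsi; exists Top, psi.
by split; [exact: theory_top| |exact: CLIr].
Qed.

(** If [chi] lies in both joins, it follows from [phi ∧ zeta] and from [psi ∧ zeta'] with [phi] in
    [x], [psi] in [y] and [zeta], [zeta'] in [z]. Then [phi ∨ psi] lies in both [x] and [y], hence
    in [z], and distributing [zeta ∧ zeta'] over it derives [chi] inside [z]. *)
Lemma theory_distributive : distributive_msl (theory Gamma).
Proof.
move=> x y z /theory_leP xyz; exists (theory_join x z), (theory_join y z).
split; [exact: theory_le_joinl|exact: theory_le_joinl|].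
apply/le_anti; rewrite lexI !theory_le_joinr /=; apply/theory_leP => chi.
move=> [[phi [zeta [xphi zzeta le]]] [psi [zeta' [ypsi zzeta' le']]]].
have zU : z (And (And zeta zeta') (Or phi psi)).
  apply: theory_and; first exact: theory_and.
  apply: xyz; split; first exact: theory_closed (CLUl _ _) xphi.
  exact: theory_closed (CLUr _ _) ypsi.
apply: theory_closed zU; apply: CL_trans (CL_distr _ _ _) _.
apply: CL_or_elim.
- apply: CL_trans le; apply: CL_and_intro (CLIr _ _) _.
  exact: CL_trans (CLIl _ _) (CLIl _ _).
- apply: CL_trans le'; apply: CL_and_intro (CLIr _ _) _.
  exact: CL_trans (CLIl _ _) (CLIr _ _).
Qed.

End CanonicalFrame.

Theorem theorem5p9 (L : Type) (p q r : L)
    (hpq : p <> q) (hpr : p <> r) (hqr : q <> r) (c : cpair L) :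
  PCL p q r c <->
  forall (d : Order.disp_t) (F : selLframe d),
    distributive_msl F -> validates F c.
Proof.
split=> [pc d F dF|].
  by apply: CL_sound pc => _ ->; exact: distributive_validates.
case: c => phi psi val.
apply: (canonical_complete (hpq := hpq) (hpr := hpr) (hqr := hqr)).
apply: val; apply: (theory_distributive hpq hpr hqr).
exact: CL_base.
Qed.
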